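(* Let $a$ and $b$ be coprime nonzero integers and let $\ell=2^\beta d$ be a positive integer such that $d$ is odd and $\beta\ge 0$. Then the following hold. 1. If $ab$ is odd, then $\ell=2^\beta d\in G_{(a,b)}$ if and only if one of the following statements holds: (a) $\beta\in\{0,1\}$ and $d=1$; (b) $\beta\in\{0,1\}$, $d\ge 3$, and there exists $s\ge 1$ such that $2^s\| \mathrm{ord}_p(\frac{a}{b})$ for every prime $p$ dividing $d$; (c) $\beta\ge 2$, $d=1$ and $2^\beta\mid (a+b)$; (d) $\beta\ge 2$, $d\ge 3$, $2^\beta\mid (a+b)$, and $d\in G_{(a,b)}$ is such that $2\|\mathrm{ord}_d(\frac{a}{b})$. 2. If $ab$ is even, then $\ell=2^\beta d\in G_{(a,b)}$ if and only if one of the following statements holds: (a) $\beta=0$ and $d=1$; (b) $\beta=0$, $d\ge 3$, and there exists $s\ge 1$ such that $2^s\|\mathrm{ord}_p(\frac{a}{b})$ for every prime $p$ dividing $d$.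
   Context: For coprime nonzero integers $a,b$, a positive integer $d$ is good with respect to $a$ and $b$ if $d\mid a^k+b^k$ for some integer $k\ge 1$; $G_{(a,b)}$ denotes the set of all such $d$. For a positive integer $n$ coprime to both $a$ and $b$, $\mathrm{ord}_n(\frac{a}{b})$ denotes the multiplicative order of $ab^{-1}$ in $(\mathbb{Z}/n\mathbb{Z})^\times$. The notation $2^s\| N$ means that $s$ is the largest integer with $2^s\mid N$. A condition of the form $2^s\|\mathrm{ord}_n(\frac{a}{b})$ is understood to include that $n$ is coprime to $ab$ (so that the order is defined). *)

(* Defs.v *)
From HB Require Import structures.
From mathcomp Require Import all_boot all_order all_algebra all_fingroup.

Set Implicit Arguments.
Unset Strict Implicit.
Unset Printing Implicit Defensive.

Import GRing.Theory.
Local Open Scope ring_scope.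

Definition good (a b : int) (d : nat) : Prop :=
  (0 < d)%N /\ exists k : nat, (0 < k)%N /\ (d%:Z %| a ^+ k + b ^+ k)%Z.

(* Only meaningful for n coprime to a and b: otherwise a / b need not be a unit
   and [insubd] may return its default, the unit 1.  At n = 1, where 'Z_1 is
   Z/2Z, {unit 'Z_1} is trivial, so the value is 1, as it should be. *)
Definition ord_quot (n : nat) (a b : int) : nat :=
  let r : 'Z_n := a%:~R / b%:~R in
  #[insubd (1%g : {unit 'Z_n}) r]%g.

Definition two_exact (s N : nat) : Prop :=
  (2 ^ s %| N)%N /\ forall t : nat, (2 ^ t %| N)%N -> (t <= s)%N.

Definition two_exact_ord (s n : nat) (a b : int) : Prop :=
  [/\ (0 < n)%N, coprimez n%:Z a, coprimez n%:Z b
    & two_exact s (ord_quot n a b)].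

(* Main.v *)
(** If n > 2 divides a^k + b^k, the order of a/b modulo n divides 2k but not k,
    so its 2-adic valuation is v_2(k) + 1: the same for n and for all its prime
    factors.  Conversely, if the orders modulo the primes dividing an odd d share
    the valuation s + 1, each such p divides a^m + b^m with m half the order of
    a/b modulo p; these exponents have common odd multiples, and one further
    p-th power gains each extra factor p.  For the 2-part with a, b odd,
    a^k + b^k is 2 mod 4 when k is even, and has the same 2-adic valuation as
    a + b when k is odd, so that beta >= 2 forces v_2(k) = 0. *)

Require Import Defs.
From HB Require Import structures.
From mathcomp Require Import all_boot all_order all_algebra all_fingroup.
From mathcomp Require Import cyclic zify ring.

Import GRing.Theory.

(** * 2-adic valuations of natural numbers *)

Lemma two_exactE s N : 0 < N -> two_exact s N <-> logn 2 N = s.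
Proof.
move=> N_gt0; rewrite /two_exact; split=> [[dvd_s max_s]|<-].
  apply/eqP; rewrite eqn_leq -pfactor_dvdn // dvd_s andbT.
  exact/max_s/pfactor_dvdnn.
by split=> [|t]; rewrite pfactor_dvdn.
Qed.

Lemma logn2_odd n : odd n -> logn 2 n = 0.
Proof. by move=> odd_n; rewrite lognE dvdn2 odd_n andbF. Qed.

(** The odd part of [m] divides [k.*2], hence [k]. If the valuation of [m] were at most that of [k],
    the 2-part would divide [k] as well, and so would [m]. *)
Lemma logn2_succ m k :
  0 < k -> m %| k.*2 -> ~~ (m %| k) -> logn 2 m = (logn 2 k).+1.
Proof.
move=> k_gt0 m_dvd2k m_ndvdk.
have k2_gt0 : 0 < k.*2 by rewrite double_gt0.
have m_gt0 : 0 < m by apply: dvdn_gt0 m_dvd2k.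
have lk2 : logn 2 k.*2 = (logn 2 k).+1 by rewrite -mul2n lognM // logn_prime.
apply/eqP; rewrite eqn_leq -{1}lk2 dvdn_leq_log //= ltnNge.
apply: contra m_ndvdk => le_mk.
rewrite -(partnC 2 m_gt0) Gauss_dvd ?coprime_partC // p_part.
rewrite pfactor_dvdn // le_mk /=.
have: m`_2^' %| k.*2 by apply: dvdn_trans m_dvd2k; exact: dvdn_part.
rewrite -mul2n Gauss_dvdr // coprime_sym coprime2n.
by have := part_pnat 2^' m; rewrite odd_2'nat.
Qed.

(** Each number is multiplied by the odd part of the other; the 2-parts already agree. *)
Lemma odd_multiple_common k m :
    0 < k -> 0 < m -> logn 2 k = logn 2 m ->
  exists t u, [/\ odd t, odd u & k * t = m * u].
Proof.
move=> k_gt0 m_gt0 lkm; exists m`_2^', k`_2^'.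
rewrite !odd_2'nat !part_pnat; split=> //.
rewrite -{1}(partnC 2 k_gt0) -{2}(partnC 2 m_gt0) !p_part lkm.
by rewrite mulnAC.
Qed.

(** * Divisibility of sums of powers *)

Section IntegerPowers.
Local Open Scope ring_scope.
Implicit Types (a b x y : int) (n k : nat).

Lemma dvdz_subX n x y k : (n %| x - y)%Z -> (n %| x ^+ k - y ^+ k)%Z.
Proof. by move=> n_xy; rewrite subrXX dvdz_mulr. Qed.

Lemma exprN_odd x k : odd k -> (- x) ^+ k = - x ^+ k.
Proof. by move=> odd_k; rewrite exprNn -signr_odd odd_k mulN1r. Qed.

Lemma dvdz_addX_odd x y k : odd k -> (x + y %| x ^+ k + y ^+ k)%Z.
Proof.
move=> odd_k; have := subrXX x (- y) k; rewrite exprN_odd // !opprK => ->.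
by rewrite dvdz_mulr.
Qed.

Lemma dvdz_addX_mul_odd d x y k m : odd m ->
  (d %| x ^+ k + y ^+ k)%Z -> (d %| x ^+ (k * m) + y ^+ (k * m))%Z.
Proof.
by move=> odd_m /dvdz_trans; apply; rewrite !exprM dvdz_addX_odd.
Qed.

(* The cofactor of x + y in x ^ p + y ^ p is congruent to p x ^ (p - 1). *)
Lemma dvdz_addX_lift p x y : odd p -> (p%:Z %| x + y)%Z ->
  (p%:Z * (x + y) %| x ^+ p + y ^+ p)%Z.
Proof.
move=> odd_p p_xy; have := subrXX x (- y) p; rewrite exprN_odd // !opprK => ->.
rewrite [p%:Z * _]mulrC dvdz_mul //.
rewrite -[X in (_ %| X)%Z](subrK (p%:Z * x ^+ p.-1)) rpredD ?dvdz_mulr //.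
have ->: p%:Z * x ^+ p.-1 = \sum_(i < p) x ^+ p.-1.
  by rewrite sumr_const card_ord -mulr_natl natz.
rewrite -sumrB.
apply: rpred_sum => i _.
have le_i : (i <= p.-1)%N by have := ltn_ord i; lia.
(* The [i]-th difference is [x ^+ (p.-1 - i)] times [(- y) ^+ i - x ^+ i], and [- y] is congruent to
   [x] modulo [p]. *)
rewrite -{2}(subnK le_i) exprD -mulrBr dvdz_mull // dvdz_subX //.
by rewrite -opprD rpredN addrC.
Qed.

(** * The order of a/b modulo n *)

Lemma intr_Zn_eq0 n (z : int) : (1 < n)%N -> (z%:~R == 0 :> 'Z_n) = (n %| z)%Z.
Proof.
move=> n_gt1.
have nat_eq0 k : (k%:R == 0 :> 'Z_n) = (n %| k)%N.
  by rewrite -val_eqE /= val_Zp_nat.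
case: z => k; first by rewrite -pmulrn nat_eq0.
by rewrite NegzE rpredN mulrNz oppr_eq0 -pmulrn nat_eq0.
Qed.

Lemma intr_Zn_unit n (z : int) :
  (1 < n)%N -> coprimez n z -> (z%:~R : 'Z_n) \is a GRing.unit.
Proof.
move=> n_gt1 /eqP co_nz; have [u [v]] := Bezoutz n z.
rewrite co_nz => /(congr1 (fun t : int => t%:~R : 'Z_n)).
rewrite rmorphD !rmorphM /= -pmulrn pchar_Zp // mulr0 add0r => vz1.
by apply/unitrP; exists v%:~R; split=> //; rewrite mulrC.
Qed.

Lemma ord_quot_gt0 n a b : (0 < ord_quot n a b)%N.
Proof. exact: order_gt0. Qed.

(** Turns the order into integer divisibility: (a/b)^k = 1 in ['Z_n], cleared of the unit b^k. *)
Lemma dvdn_ord_quot n a b k :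
    (1 < n)%N -> coprimez n a -> coprimez n b ->
  (ord_quot n a b %| k)%N = (n %| a ^+ k - b ^+ k)%Z.
Proof.
move=> n_gt1 co_na co_nb.
have Ua := intr_Zn_unit n a n_gt1 co_na; have Ub := intr_Zn_unit n b n_gt1 co_nb.
(* Coprimality makes a/b a unit, so [insubd] does not fall back on its default. *)
rewrite /ord_quot order_dvdn -val_eqE /= FinRing.val_unitX insubdK; last first.
  by rewrite unfold_in /= unitrMl // unitrV.
rewrite expr_div_n -(inj_eq (mulIr (unitrX k Ub))) mul1r divrK ?unitrX //.
by rewrite -subr_eq0 -!rmorphXn -rmorphB /= intr_Zn_eq0.
Qed.

(** A common divisor of n and a divides a^k, hence also b^k, and these powers are coprime. *)
Lemma coprimez_addX_dvd n a b k :
    coprimez a b -> (0 < k)%N -> (n %| a ^+ k + b ^+ k)%Z ->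
  coprimez n a /\ coprimez n b.
Proof.
have half u v : coprimez u v -> (0 < k)%N -> (n %| u ^+ k + v ^+ k)%Z ->
    coprimez n u.
  move=> co_uv k_gt0 n_uv; have gn := dvdz_gcdl n u.
  have gu : (gcdz n u %| u ^+ k)%Z.
    by rewrite -(prednK k_gt0) exprS dvdz_mulr // dvdz_gcdr.
  have := dvdz_trans gn n_uv; rewrite rpredDl // => gv.
  have: (gcdz n u %| gcdz (u ^+ k) (v ^+ k))%Z by rewrite dvdz_gcd gu gv.
  by move: (coprimezXl k (coprimezXr k co_uv)) => /eqP ->; rewrite dvdz1.
move=> co_ab k_gt0 n_ab; split; first exact: half n_ab.
by apply: (half b a); rewrite 1?coprimez_sym // addrC.
Qed.

(** The order divides 2k because a^k + b^k divides a^(2k) - b^(2k). If it divided k, then n would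
    divide 2a^k, hence 2, against n > 2. *)
Lemma logn2_ord_quot n a b k :
    coprimez a b -> (0 < k)%N -> (2 < n)%N -> (n %| a ^+ k + b ^+ k)%Z ->
  logn 2 (ord_quot n a b) = (logn 2 k).+1.
Proof.
move=> co_ab k_gt0 n_gt2 n_ab.
have [co_na co_nb] := coprimez_addX_dvd _ _ _ _ co_ab k_gt0 n_ab.
have n_gt1 : (1 < n)%N by apply: ltnW.
apply: logn2_succ => //; rewrite dvdn_ord_quot //.
  by rewrite -muln2 !exprM subr_sqr dvdz_mull.
apply/negP=> n_sub.
have: (n %| a ^+ k * 2)%Z.
  have ->: a ^+ k * 2 = a ^+ k - b ^+ k + (a ^+ k + b ^+ k) by ring.
  exact: rpredD.
by rewrite Gauss_dvdzr ?coprimezXr // => /(@dvdn_leq n 2 isT); lia.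
Qed.

Lemma two_exact_ord_addX n a b k :
    coprimez a b -> (0 < k)%N -> (2 < n)%N -> (n %| a ^+ k + b ^+ k)%Z ->
  two_exact_ord (logn 2 k).+1 n a b.
Proof.
move=> co_ab k_gt0 n_gt2 n_ab.
have [co_na co_nb] := coprimez_addX_dvd _ _ _ _ co_ab k_gt0 n_ab.
split=> //; first exact: ltn_trans n_gt2.
by rewrite two_exactE ?ord_quot_gt0 // (logn2_ord_quot _ _ _ k).
Qed.

(** * Odd moduli, from primes to products *)

Lemma prime_dvd_addX p a b s :
    prime p -> two_exact_ord s.+1 p a b ->
  exists m, [/\ (0 < m)%N, logn 2 m = s & (p %| a ^+ m + b ^+ m)%Z].
Proof.
move=> p_pr [_ co_pa co_pb]; rewrite two_exactE ?ord_quot_gt0 // => log_o.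
have o_gt0 := ord_quot_gt0 p a b; have p_gt1 := prime_gt1 p_pr.
have o2 : (2 %| ord_quot p a b)%N by rewrite (pfactor_dvdn 1) // log_o.
set m := (ord_quot p a b %/ 2)%N.
have oE : ord_quot p a b = (m * 2)%N by rewrite divnK.
have m_gt0 : (0 < m)%N by move: o_gt0; rewrite oE; lia.
exists m; split=> //.
  by move: log_o; rewrite oE mulnC lognM // logn_prime // => -[].
have: (p %| a ^+ (m * 2) - b ^+ (m * 2))%Z.
  by rewrite -dvdn_ord_quot // oE.
(* The prime divides one of a^m - b^m and a^m + b^m; the former would make the order 2m divide m. *)
rewrite !exprM subr_sqr dvdzE abszM Euclid_dvdM // => /orP[] // p_sub.
have: (ord_quot p a b %| m)%N by rewrite dvdn_ord_quot.
by move/(dvdn_leq m_gt0); rewrite oE; lia.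
Qed.

(* Induction on d = p d': an odd multiple K of the exponent for d' makes both
   p and d' divide a ^ K + b ^ K, and raising to the p-th power then gains
   the missing factor p, whether or not p divides d'. *)
Lemma dvdz_addX_of_primes a b s d :
    odd d -> (forall p, prime p -> (p %| d)%N -> two_exact_ord s.+1 p a b) ->
  exists k, [/\ (0 < k)%N, logn 2 k = s & (d %| a ^+ k + b ^+ k)%Z].
Proof.
have [n] := ubnP d; elim: n d => // n IHn d lt_dn odd_d primes_d.
have d_gt0 := odd_gt0 odd_d.
have [->|d_neq1] := eqVneq d 1%N.
  by exists (2 ^ s)%N; rewrite expn_gt0 pfactorK.
have [|p p_pr p_d] := @pdivP d; first lia.
have dE := divnK p_d; set d' := (d %/ p)%N in dE.
have odd_p := dvdn_odd p_d odd_d.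
have [||q q_pr q_d'|k [k_gt0 log_k d'_k]] := IHn d'.
- exact: leq_trans (ltn_Pdiv (prime_gt1 p_pr) d_gt0) lt_dn.
- by move: odd_d; rewrite -dE oddM => /andP[].
- by apply: primes_d; rewrite // -dE dvdn_mulr.
have [m [m_gt0 log_m p_m]] := prime_dvd_addX p a b s p_pr (primes_d p p_pr p_d).
have [|t [u [odd_t odd_u ktE]]] := odd_multiple_common k m k_gt0 m_gt0.
  by rewrite log_k.
have t_gt0 := odd_gt0 odd_t; have p_gt0 := odd_gt0 odd_p.
(* Both [t] and [p] are odd, so the valuation of the exponent stays [s]. *)
exists (k * t * p)%N; split; first by rewrite !muln_gt0 k_gt0 t_gt0.
  by rewrite !lognM ?muln_gt0 ?k_gt0 // log_k !logn2_odd // !addn0.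
have d'_kt := dvdz_addX_mul_odd _ _ _ _ t odd_t d'_k.
have p_kt : (p %| a ^+ (k * t) + b ^+ (k * t))%Z.
  by rewrite ktE dvdz_addX_mul_odd.
have := dvdz_addX_lift p _ _ odd_p p_kt; rewrite -!exprM; apply: dvdz_trans.
by rewrite -dE [(d' * p)%N]mulnC PoszM dvdz_mul.
Qed.

Lemma good_oddP a b d : coprimez a b -> odd d -> (3 <= d)%N ->
  good a b d <-> exists s, (1 <= s)%N /\
    forall p, prime p -> (p %| d)%N -> two_exact_ord s p a b.
Proof.
move=> co_ab odd_d d_ge3; split=> [[_ [k [k_gt0 d_k]]]|[[|s] [// _ primes_d]]].
  (* One exponent k serves every prime factor of d, so this valuation does not depend on p. *)
  exists (logn 2 k).+1; split=> // p p_pr p_d.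
  have p_gt2 : (2 < p)%N by rewrite odd_prime_gt2 // (dvdn_odd p_d).
  by apply: two_exact_ord_addX => //; apply: dvdz_trans d_k.
have [k [k_gt0 _ d_k]] := dvdz_addX_of_primes a b s d odd_d primes_d.
by split; [apply: odd_gt0 | exists k].
Qed.

(** * Parity and the factor 2^beta *)

Lemma dvdz2 x : (2 %| x)%Z = ~~ odd `|x|.
Proof. by rewrite dvdzE dvdn2. Qed.

Lemma odd_abszD x y : odd `|x + y| = odd `|x| (+) odd `|y|.
Proof. lia. Qed.

Lemma odd_abszX x k : (0 < k)%N -> odd `|x ^+ k| = odd `|x|.
Proof. by move=> k_gt0; rewrite abszX oddX; case: k k_gt0. Qed.

Lemma odd_absz_sum k (F : nat -> int) :
  (forall i, odd `|F i|) -> odd `|\sum_(i < k) F i| = odd k.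
Proof.
move=> odd_F; elim: k => [|k IHk]; first by rewrite big_ord0.
by rewrite big_ord_recr odd_abszD IHk odd_F addbT.
Qed.

Lemma dvdz4_sub1 x k : odd `|x| -> ~~ odd k -> (4 %| x ^+ k - 1)%Z.
Proof.
move=> odd_x even_k; rewrite -(even_halfK even_k) -mul2n exprM.
rewrite -[X in _ - X](expr1n _ k./2); apply: (dvdz_subX 4).
have [c ->] : exists c, x = c * 2 + 1 by exists ((x - 1) %/ 2)%Z; lia.
have ->: (c * 2 + 1) ^+ 2 - 1 = 4 * (c * (c + 1)) by ring.
by rewrite dvdz_mulr.
Qed.

(** For k odd, the cofactor of a + b is a sum of k odd terms, hence odd. For k even, both powers are
    1 modulo 4, so 4 does not divide their sum. *)
Lemma pow2_dvdz_addX a b beta k :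
    odd `|a| -> odd `|b| -> (2 <= beta)%N ->
  ((2 ^ beta)%N %| a ^+ k + b ^+ k)%Z = odd k && ((2 ^ beta)%N %| a + b)%Z.
Proof.
move=> odd_a odd_b beta_ge2; have [odd_k|even_k] /= := boolP (odd k).
  have := subrXX a (- b) k; rewrite exprN_odd // !opprK => ->.
  rewrite Gauss_dvdzl // coprimezE coprimeXl // coprime2n.
  rewrite (odd_absz_sum k (fun i => a ^+ (k.-1 - i) * (- b) ^+ i)) // => i.
  by rewrite abszM oddM !abszX abszN !oddX odd_a odd_b !orbT.
apply/negP=> beta_ab.
have four_ab : (4 %| a ^+ k + b ^+ k)%Z.
  by apply: dvdz_trans beta_ab; rewrite dvdzE; apply: (dvdn_exp2l 2 beta_ge2).
have := dvdz4_sub1 _ _ odd_a even_k; have := dvdz4_sub1 _ _ odd_b even_k.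
by move: four_ab; lia.
Qed.

Lemma pow2_odd_dvdz beta d x : odd d ->
  ((2 ^ beta * d)%N %| x)%Z = ((2 ^ beta)%N %| x)%Z && (d %| x)%Z.
Proof.
by move=> odd_d; rewrite !dvdzE Gauss_dvd // coprimeXl // coprime2n.
Qed.

(** A sum of two odd powers is even, so a single factor 2 comes for free. *)
Lemma good_pow2_odd_le1 a b beta d : odd `|a| -> odd `|b| -> odd d ->
  (beta <= 1)%N -> good a b (2 ^ beta * d) <-> good a b d.
Proof.
move=> odd_a odd_b odd_d beta_le1; have d_gt0 := odd_gt0 odd_d.
have dvdE k : (0 < k)%N ->
    ((2 ^ beta * d)%N %| a ^+ k + b ^+ k)%Z = (d %| a ^+ k + b ^+ k)%Z.
  move=> k_gt0; rewrite pow2_odd_dvdz //.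
  suff ->: ((2 ^ beta)%N %| a ^+ k + b ^+ k)%Z by [].
  apply: (@dvdz_trans 2); first by rewrite dvdzE; apply: (dvdn_exp2l 2 beta_le1).
  by rewrite dvdz2 odd_abszD !odd_abszX // odd_a odd_b.
by split=> -[_ [k [k_gt0]]] => [|d_k]; [rewrite dvdE //|]; split;
  rewrite ?muln_gt0 ?expn_gt0 //; exists k; rewrite ?dvdE.
Qed.

Lemma good_pow2_odd_ge2 a b beta d : odd `|a| -> odd `|b| -> odd d ->
    (2 <= beta)%N ->
  good a b (2 ^ beta * d) <->
  ((2 ^ beta)%N %| a + b)%Z /\
    exists k, [/\ (0 < k)%N, odd k & (d %| a ^+ k + b ^+ k)%Z].
Proof.
move=> odd_a odd_b odd_d beta_ge2.
split=> [[_ [k [k_gt0]]]|[beta_ab [k [k_gt0 odd_k d_k]]]].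
  rewrite pow2_odd_dvdz // pow2_dvdz_addX // -andbA => /and3P[odd_k beta_ab d_k].
  by split=> //; exists k.
split; first by rewrite muln_gt0 expn_gt0 (odd_gt0 odd_d).
by exists k; rewrite pow2_odd_dvdz // pow2_dvdz_addX // odd_k beta_ab.
Qed.

(** Since the order has valuation one more than that of k, it is exactly divisible by 2 precisely
    when k is odd; any exponent witnessing [good a b d] is then odd. *)
Lemma exists_odd_addX a b d : coprimez a b -> (2 < d)%N ->
  (exists k, [/\ (0 < k)%N, odd k & (d %| a ^+ k + b ^+ k)%Z]) <->
  good a b d /\ two_exact_ord 1 d a b.
Proof.
move=> co_ab d_gt2; split=> [[k [k_gt0 odd_k d_k]]|].
  split; first by split; [apply: ltn_trans d_gt2 | exists k].
  have <-: (logn 2 k).+1 = 1%N by rewrite logn2_odd.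
  exact: two_exact_ord_addX.
move=> [[_ [k [k_gt0 d_k]]] [_ _ _]].
rewrite two_exactE ?ord_quot_gt0 // (logn2_ord_quot _ _ _ k) // => -[log_k].
exists k; split=> //; rewrite -[odd k]negbK -dvdn2 (pfactor_dvdn 1) //.
by rewrite log_k.
Qed.

Lemma good1 a b : good a b 1.
Proof. by split=> //; exists 1%N; rewrite dvd1z. Qed.

(** If d were even, 2 would divide a^k + b^k and so be coprime to both a and b, hence to their even
    product. *)
Lemma good_odd a b d : coprimez a b -> (2 %| a * b)%Z -> good a b d -> odd d.
Proof.
move=> co_ab ab_even [_ [k [k_gt0 d_k]]]; rewrite -[odd d]negbK -dvdn2.
apply/negP=> d_even.
have [] := coprimez_addX_dvd 2 a b k co_ab k_gt0 (@dvdz_trans d 2 _ d_even d_k).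
move=> co_2a co_2b; have: coprimez 2 (a * b) by rewrite coprimezMr co_2a.
by rewrite /coprimez (gcdz_idPl ab_even).
Qed.
End IntegerPowers.
Theorem theorem2p1 (a b : int) (a_neq0 : a <> 0%R) (b_neq0 : b <> 0%R)
    (coprime_ab : coprimez a b)
    (l beta d : nat) (l_gt0 : 0 < l) (lE : l = 2 ^ beta * d) (odd_d : odd d) :
  (~ (2 %| (a * b)%R)%Z ->
     (good a b l <->
        [\/ (beta = 0 \/ beta = 1) /\ d = 1,
            [/\ beta = 0 \/ beta = 1, 3 <= d
              & exists s : nat, 1 <= s /\
                  forall p : nat, prime p -> p %| d -> two_exact_ord s p a b],
            [/\ 2 <= beta, d = 1 & ((2 ^ beta)%N%:Z %| (a + b)%R)%Z]
          | [/\ 2 <= beta, 3 <= d, ((2 ^ beta)%N%:Z %| (a + b)%R)%Z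
              & good a b d /\ two_exact_ord 1 d a b]]))
  /\
  ((2 %| (a * b)%R)%Z ->
     (good a b l <->
        (beta = 0 /\ d = 1)
        \/ [/\ beta = 0, 3 <= d
             & exists s : nat, 1 <= s /\
                 forall p : nat, prime p -> p %| d -> two_exact_ord s p a b])).

Proof.
have d_gt0 := odd_gt0 odd_d.
have d1_or_ge3 : d = 1 \/ 3 <= d by lia.
split=> [/negP|] ab_even.
  move: (ab_even); rewrite dvdz2 negbK abszM oddM => /andP[odd_a odd_b].
  rewrite lE; have [beta_le1|beta_ge2] := leqP beta 1.
    rewrite good_pow2_odd_le1 //.
    have beta01 : beta = 0 \/ beta = 1 by lia.
    case: d1_or_ge3 => [->|d_ge3]; first by split=> _; [apply: Or41 | exact: good1].
    apply: iff_trans (good_oddP _ _ _ coprime_ab odd_d d_ge3) _.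
    by split=> [|[] []] //; [move=> primes_d; apply: Or42 | lia].
  rewrite good_pow2_odd_ge2 //; case: d1_or_ge3 => [->|d_ge3].
    split=> [[beta_ab _]|]; first by apply: Or43.
    case=> [[]|[]|[]|[]] //; try lia.
    by move=> _ _ beta_ab; split=> //; exists 1; rewrite dvd1z.
  have oddE := exists_odd_addX _ _ _ coprime_ab d_ge3.
  split=> [[beta_ab /oddE]|]; first by move=> good_d; apply: Or44.
  by case=> [[]|[]|[]|[]] //; [lia.. | move=> _ _ beta_ab /oddE].
split=> [good_l|].
  (* Applied to [l] itself: 2^beta d is odd only for beta = 0. *)
  have := good_odd _ _ _ coprime_ab ab_even good_l.
  rewrite lE oddM oddX orbF => /andP[/eqP beta0 _].
  move: good_l; rewrite lE beta0 mul1n => good_d.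
  by case: d1_or_ge3 => [->|d_ge3]; [left | right; split=> //; apply/good_oddP].
rewrite lE => -[[-> ->]|[-> d_ge3 primes_d]]; first exact: good1.
by rewrite mul1n; apply/good_oddP.
Qed.
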